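(* Let $H^\omega$, $\Lambda_L$, $H^\omega_{\Lambda_L}$, $\beta_L$, $N_L^\omega$, $\tilde N_L^\omega$ be as in the context, with $\alpha>0$, $\delta>1$ and $d-\alpha(\delta-1)>0$. If $E<-2d$ and $\epsilon=-2d-E>0$, then $$\frac{1}{2}\frac{1}{(4d+\epsilon)^{\delta-1}}\le \liminf_{L\to\infty}\frac{1}{\beta_L}\mathbb{E}\big(N^{\omega}_{L}(E)\big)\le \limsup_{L\to\infty}\frac{1}{\beta_L}\mathbb{E}\big(N^{\omega}_{L}(E)\big)\le \frac{1}{2}\frac{1}{\epsilon^{\delta-1}}.$$ If $E=2d+\epsilon$ with $\epsilon>0$, then $$\frac{1}{2}\frac{1}{(4d+\epsilon)^{\delta-1}}\le \liminf_{L\to\infty}\frac{1}{\beta_L}\mathbb{E}\big(\tilde N^{\omega}_{L}(E)\big)\le \limsup_{L\to\infty}\frac{1}{\beta_L}\mathbb{E}\big(\tilde N^{\omega}_{L}(E)\big)\le \frac{1}{2}\frac{1}{\epsilon^{\delta-1}}.$$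
   Context: Let $d\ge1$ be an integer. Let $\{q_n\}_{n\in\mathbb{Z}^d}$ be i.i.d. real random variables on a probability space $(\Omega,\mathcal{B},\mathbb{P})$ (expectation $\mathbb{E}$), whose common distribution $\mu$ has density $\rho(x)=0$ for $|x|<1$ and $\rho(x)=\frac{\delta-1}{2}|x|^{-\delta}$ for $|x|\ge1$, for some $\delta>1$. Let $\{a_n\}_{n\in\mathbb{Z}^d}$ be positive reals with $a_n\simeq|n|^{-\alpha}$, $\alpha>0$ (i.e. there are constants $0<c_1\le c_2$ with $c_1|n|^{-\alpha}\le a_n\le c_2|n|^{-\alpha}$ for all $n\ne0$; $|\cdot|$ is the Euclidean norm). Assume $d-\alpha(\delta-1)>0$. On $\ell^2(\mathbb{Z}^d)$, with standard basis $\{\delta_n\}$, let $(\Delta u)(n)=\sum_{|m-n|=1}u(m)$ and $H^\omega=-\Delta+V^\omega$, where $(V^\omega u)(n)=a_nq_n(\omega)u(n)$. For $L\in\mathbb{N}$ let $\Lambda_L=\{n\in\mathbb{Z}^d:|n_i|\le L,\ i=1,\dots,d\}$ and let $H^\omega_{\Lambda_L}$ be the finite symmetric matrix $(\langle\delta_n,H^\omega\delta_m\rangle)_{n,m\in\Lambda_L}$. Put $\beta_L=\sum_{n\in\Lambda_L}a_n^{\delta-1}$ (which tends to $\infty$ as $L\to\infty$). With eigenvalues counted with multiplicity, $N_L^\omega(E)$ is the number of eigenvalues of $H^\omega_{\Lambda_L}$ that are $\le E$, and $\tilde N_L^\omega(E)$ is the number of eigenvalues of $H^\omega_{\Lambda_L}$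 that are $\ge E$. *)

(* Defs.v *)
From HB Require Import structures.
From mathcomp Require Import all_boot all_order all_algebra finmap.
From mathcomp Require Import all_classical all_reals all_analysis.

Set Implicit Arguments.
Unset Strict Implicit.
Unset Printing Implicit Defensive.

Import Order.TTheory GRing.Theory Num.Theory.
Import numFieldNormedType.Exports.

Local Open Scope classical_set_scope.
Local Open Scope ring_scope.

Definition enorm (R : realType) (d : nat) (n : 'rV[int]_d) : R :=
  Num.sqrt (\sum_(i < d) (n 0 i)%:~R ^+ 2).

Definition box (d L : nat) : set 'rV[int]_d :=
  [set n | forall i, `|n 0 i| <= L%:Z].

Arguments box : clear implicits.

Lemma finite_box (d L : nat) : finite_set (box d L).
Proof.
pose f (v : 'rV['I_(L + L).+1]_d) : 'rV[int]_d :=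
  map_mx (fun k : 'I_(L + L).+1 => (k : nat)%:Z - L%:Z) v.
apply: (@sub_finite_set _ _ (f @` setT)); last first.
  exact/finite_image/finite_finset.
move=> n nL; exists (\row_i inord `|(n 0 i + L%:Z)%R|%N) => //.
apply/rowP => i; rewrite !mxE.
have := nL i; rewrite ler_norml => /andP[nl nr].
have n0 : 0 <= n 0 i + L%:Z by rewrite -lerBlDr sub0r.
rewrite inordK; first by rewrite gez0_abs// addrK.
by rewrite ltnS -lez_nat gez0_abs// PoszD lerD2r.
Qed.

(* A genuine enumeration of [box d L] thanks to [finite_box]
   ([fset_set] returns the empty set on infinite sets). *)
Definition Lambda (d L : nat) : {fset 'rV[int]_d} := fset_set (box d L).

Arguments Lambda : clear implicits.

Lemma in_Lambda (d L : nat) (n : 'rV[int]_d) :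
  (n \in Lambda d L) = [forall i, `|n 0 i| <= L%:Z].
Proof.
rewrite in_fset_set; last exact: finite_box.
by apply/idP/forallP => [/set_mem|nL]; last exact: mem_set.
Qed.

Section anderson.
Context {R : realType} {d : nat}.
Implicit Types (u v : 'rV[int]_d -> R) (n m : 'rV[int]_d).

Definition basis_vec n : 'rV[int]_d -> R := fun m => (m == n)%:R.

Definition laplacian u : 'rV[int]_d -> R :=
  fun n => \sum_(m \in [set m | enorm R (m - n) = 1]) u m.

(* The operator -Delta + v on all functions on the lattice; since it has finite
   range, only finitely supported functions matter for the truncations below. *)
Definition schrodinger v u : 'rV[int]_d -> R :=
  fun n => - laplacian u n + v n * u n.

(* <delta_n, H delta_m> is the value of H delta_m at the site n. *)
Definition schrodinger_mx v (L : nat) : 'M[R]_(#|` Lambda d L|) :=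
  \matrix_(i, j)
    schrodinger v (basis_vec (nth 0 (Lambda d L) j)) (nth 0 (Lambda d L) i).

Definition beta (a : 'rV[int]_d -> R) (delta : R) (L : nat) : R :=
  \sum_(n <- Lambda d L) a n `^ (delta - 1).

End anderson.

(* The number of eigenvalues of M lying in A, each counted with its
   multiplicity, the dimension of its eigenspace (for the symmetric matrices
   considered here this is also the algebraic multiplicity). *)
Definition eigen_count (R : realType) (k : nat) (M : 'M[R]_k) (A : set R) : nat :=
  (\sum_(l \in [set l | eigenvalue M l /\ A l]) \rank (eigenspace M l))%N.

Definition eigen_count_le (R : realType) (d : nat) (v : 'rV[int]_d -> R)
  (L : nat) (E : R) : nat := eigen_count (schrodinger_mx v L) [set l | l <= E].

Definition eigen_count_ge (R : realType) (d : nat) (v : 'rV[int]_d -> R)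
  (L : nat) (E : R) : nat := eigen_count (schrodinger_mx v L) [set l | E <= l].

Definition mutually_independent (disp : measure_display)
  (T : measurableType disp) (R : realType) (P : probability T R)
  (I : choiceType) (X : I -> {RV P >-> R}) : Prop :=
  forall (F : {fset I}) (B : I -> set R),
    (forall i, i \in F -> measurable (B i)) ->
    P (\bigcap_(i in [set` F]) (X i @^-1` B i)) =
    (\prod_(i <- F) P (X i @^-1` B i))%E.

Definition pareto_pdf (R : realType) (delta : R) (x : R) : R :=
  if `|x| < 1 then 0 else (delta - 1) / 2 * `|x| `^ (- delta).

Definition has_density (disp : measure_display)
  (T : measurableType disp) (R : realType) (P : probability T R)
  (X : {RV P >-> R}) (rho : R -> R) : Prop :=
  forall A : set R, measurable A ->
    distribution P X A = (\int[lebesgue_measure]_(x in A) (rho x)%:E)%E.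

(* Main.v *)
Require Import Defs.
From HB Require Import structures.
From mathcomp Require Import all_boot all_order all_algebra finmap.
From mathcomp Require Import all_classical all_reals all_analysis.
From mathcomp Require Import spectral complex measurable_realfun ring lra.

(** The row sums of the adjacency matrix of the lattice are at most [2d], so by
    the min-max principle the number of eigenvalues of [-Delta + V] on the box
    that are at most [E] lies between the numbers of sites with
    [V n <= E - 2d] and with [V n <= E + 2d]. The expectation of such a site
    count is a sum of Pareto tails: [P (a_n q_n <= -t)] is at most
    [a_n ^ (delta - 1) / (2 t ^ (delta - 1))], with equality as soon as
    [a_n <= t], hence for all but finitely many [n]. Summing over the box gives
    [beta_L / (2 t ^ (delta - 1))] up to a bounded error, and [beta_L] diverges.
    The upper edge of the spectrum is the lower edge of [Delta - V]. *)

Import Order.TTheory GRing.Theory Num.Theory.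
Import numFieldNormedType.Exports.

Local Open Scope classical_set_scope.
Local Open Scope ring_scope.

(** * Linear algebra *)

Lemma row_free_rowsub1 (F : fieldType) (m k : nat) (f : 'I_m -> 'I_k) :
  injective f -> row_free (rowsub f 1%:M : 'M[F]_(m, k)).
Proof.
move=> finj; apply/row_freeP; exists (rowsub f 1%:M)^T.
apply/matrixP => i j; rewrite !mxE (bigD1 (f i))//= !mxE eqxx mul1r big1.
  by rewrite addr0 (inj_eq finj) eq_sym.
by move=> l lfi; rewrite !mxE eq_sym (negbTE lfi) mul0r.
Qed.

(** Let [S] be the support of [v]. The matrix factors through its [#|S|] rows indexed by [S], which
    bounds the rank from above. Those rows are free, with a right inverse made of the reciprocals of
    the entries, which bounds it from below. *)
Lemma mxrank_diag (F : fieldType) (k : nat) (v : 'rV[F]_k) :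
  \rank (diag_mx v) = #|[set i | v 0 i != 0]|%SET.
Proof.
set S := [set i | v 0 i != 0]%SET.
pose f (i : 'I_#|S|) : 'I_k := enum_val i.
have finj : injective f by exact: enum_val_inj.
apply/eqP; rewrite eqn_leq; apply/andP; split.
  have -> : diag_mx v = (rowsub f 1%:M)^T *m rowsub f (diag_mx v).
    apply/matrixP => i j; rewrite !mxE.
    have [iS|iS] := boolP (i \in S); last first.
      have /eqP vi0 : v 0 i == 0 by move: iS; rewrite inE negbK.
      rewrite vi0 mul0rn big1// => l _; rewrite !mxE.
      have [fli|] := eqVneq (f l) i; last by rewrite mul0r.
      by move: iS; rewrite -fli enum_valP.
    rewrite (bigD1 (enum_rank_in iS i))//= !mxE {1 2 3}/f enum_rankK_in// eqxx mul1r.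
    rewrite big1 ?addr0// => l lI; rewrite !mxE.
    have [fli|] := eqVneq (f l) i; last by rewrite mul0r.
    case/eqP: lI; apply: finj; rewrite fli.
    by rewrite /f enum_rankK_in.
  exact: mulmx_max_rank.
have /eqP <- : row_free (rowsub f (diag_mx v)).
  apply/row_freeP; exists (rowsub f (diag_mx (\row_i (v 0 i)^-1)))^T.
  apply/matrixP => i j; rewrite !mxE (bigD1 (f i))//= !mxE eqxx mulr1n big1.
    rewrite addr0 (inj_eq finj) [j == i]eq_sym; case: eqP => [->|_];
      last by rewrite mulr0.
    rewrite mulr1n divff//; have := enum_valP j; by rewrite inE.
  by move=> l lfi; rewrite !mxE [f i == l]eq_sym (negbTE lfi) mulr0n mul0r.
apply: mxrankS; exact: rowsub_sub.
Qed.

(** The coordinates of [c] in [S1] are the unknowns and the vanishing of [c *m P] on [S2] gives the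
    equations, so there are more unknowns than equations. In use, [c] is indexed by eigenvectors and
    [c *m P] by sites. *)
Lemma exists_row_of_card_lt (F : fieldType) (k : nat) (P : 'M[F]_k)
    (S1 S2 : {set 'I_k}) : P \in unitmx -> (#|S2| < #|S1|)%N ->
  exists c : 'rV[F]_k, [/\ c *m P != 0, forall j, j \notin S1 -> c 0 j = 0 &
    forall j, j \in S2 -> (c *m P) 0 j = 0].
Proof.
move=> Pu S21.
pose f (i : 'I_#|S1|) : 'I_k := enum_val i.
pose g (i : 'I_#|S2|) : 'I_k := enum_val i.
pose N := colsub g (rowsub f P).
have /rowV0Pn [c0 /sub_kermxP c0N c0n0] : kermx N != 0.
  rewrite -mxrank_eq0 mxrank_ker subn_eq0 -ltnNge.
  exact: leq_ltn_trans (rank_leq_col _) S21.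
exists (c0 *m rowsub f 1%:M); split.
- apply: contra_neq c0n0 => /(congr1 (mulmx^~ (invmx P))).
  rewrite mulmxK// mul0mx => c00.
  apply: (row_free_inj (row_free_rowsub1 F _ _ f enum_val_inj)).
  by rewrite c00 mul0mx.
- move=> j jS; rewrite !mxE big1// => i _; rewrite !mxE.
  have [fij|] := eqVneq (f i) j; last by rewrite mulr0.
  by move: jS; rewrite -fij enum_valP.
- move=> j jS; rewrite -mulmxA mul_rowsub_mx mul1mx.
  have := congr1 (fun X : 'rV__ => X 0 (enum_rank_in jS j)) c0N.
  rewrite !mxE; apply: etrans.
  by apply: eq_bigr => i _; rewrite !mxE /g enum_rankK_in.
Qed.

(** * Spectral theorem and quadratic forms over the complexification *)

Section complexified.
Local Open Scope sesquilinear_scope.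
Variable R : rcfType.
Local Notation toC := (real_complex R).

(** The complexification of [M] is Hermitian, hence normal and unitarily diagonalisable with real
    spectrum. Only the change of basis [P] is complex; the eigenvalues [D] come back to [R]. *)
Lemma symmetric_spectral (k : nat) (M : 'M[R]_k) : M^T = M ->
  exists (P : 'M[R[i]]_k) (D : 'rV[R]_k), P \is unitarymx /\
    map_mx toC M = invmx P *m diag_mx (map_mx toC D) *m P.
Proof.
move=> Msym; set A := map_mx toC M.
have Aherm : A \is hermsymmx.
  apply/is_hermitianmxP; rewrite expr0 scale1r.
  apply/matrixP => i j; rewrite !mxE.
  by rewrite -[in LHS]Msym mxE; apply/esym; exact: conjc_real.
have /mxOverP Dreal := hermitian_spectral_diag_real Aherm.
have /hermitian_normalmx /orthomx_spectralP AE := Aherm.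
exists (spectralmx A), (map_mx (@complex.Re R) (spectral_diag A)).
split; first exact: spectral_unitarymx.
rewrite [LHS]AE; congr (_ *m diag_mx _ *m _).
by apply/rowP => i; rewrite !mxE RRe_real.
Qed.

(** Extending scalars preserves ranks, and over [R[i]] the matrix [M - l] is conjugate to the
    diagonal matrix with entries [D 0 i - l], whose kernel dimension is the number of zero
    entries. *)
Lemma mxrank_eigenspace_spectral (k : nat) (M : 'M[R]_k) (P : 'M[R[i]]_k)
    (D : 'rV[R]_k) (l : R) : P \is unitarymx ->
  map_mx toC M = invmx P *m diag_mx (map_mx toC D) *m P ->
  \rank (eigenspace M l) = #|[set i | D 0 i == l]|%SET.
Proof.
move=> /unitarymx_unit Pu ME.
rewrite -(mxrank_map toC) map_eigenspace mxrank_ker ME.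
have -> : invmx P *m diag_mx (map_mx toC D) *m P - (toC l)%:M =
    invmx P *m diag_mx (map_mx toC (D - const_mx l)) *m P.
  have lE : (toC l)%:M = invmx P *m (toC l)%:M *m P.
    by rewrite mul_mx_scalar -scalemxAl mulVmx// scalemx1.
  rewrite [X in _ - X]lE.
  rewrite -mulmxBl -mulmxBr; congr (_ *m _ *m _).
  by rewrite map_mxB linearB/= map_const_mx diag_const_mx.
rewrite mxrankMfree ?row_free_unit//.
rewrite -mxrank_tr trmx_mul mxrankMfree ?row_free_unit ?unitmx_tr ?unitmx_inv//.
rewrite mxrank_tr mxrank_diag.
rewrite [in RHS]cardsCs card_ord; congr (_ - _)%N; apply: eq_card => i.
rewrite !inE !mxE.
by rewrite fmorph_eq0 subr_eq0.
Qed.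


Lemma mulmx_diag_adj (k : nat) (c : 'rV[R[i]]_k) (D : 'rV[R]_k) :
  (c *m diag_mx (map_mx toC D) *m c^t*) 0 0 =
  \sum_i (toC (D 0 i) * `|c 0 i| ^+ 2 : R[i]).
Proof.
rewrite mul_mx_diag mxE; apply: eq_bigr => i _.
by rewrite !mxE mulrAC mulrC normCK.
Qed.

Lemma unitary_norm (k : nat) (c : 'rV[R[i]]_k) (P : 'M[R[i]]_k) :
  P \is unitarymx ->
  \sum_i (`|(c *m P) 0 i| ^+ 2 : R[i]) = \sum_i `|c 0 i| ^+ 2.
Proof.
have normE (x : 'rV[R[i]]_k) : \sum_i (`|x 0 i| ^+ 2 : R[i]) = (x *m x^t*) 0 0.
  by rewrite mxE; apply: eq_bigr => i _; rewrite !mxE normCK.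
move=> /unitarymxP PP; rewrite !normE trmx_mul map_mxM mulmxA -(mulmxA c).
by rewrite PP mulmx1.
Qed.

(** Schur test: the inequality [2 |x_i| |x_j| <= |x_i|^2 + |x_j|^2] leaves only row sums and column
    sums of [|S|], and symmetry bounds both by [C]. *)
Lemma norm_quadratic_le (k : nat) (S : 'M[R]_k) (C : R) (x : 'rV[R[i]]_k) :
  S^T = S -> (forall i, \sum_j `|S i j| <= C) ->
  `|(x *m map_mx toC S *m x^t*) 0 0| <= toC C * \sum_i `|x 0 i| ^+ 2.
Proof.
move=> Ssym SC.
have normS i j : `|toC (S i j)| = toC `|S i j|.
  have [s0|s0] := leP 0 (S i j).
    by rewrite !ger0_norm// lecR.
  by rewrite !ltr0_norm ?raddfN// ltcR.
rewrite mxE; under eq_bigr do rewrite mxE mulr_suml.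
apply: le_trans (ler_norm_sum _ _ _) _.
apply: (@le_trans _ _ (\sum_j \sum_i
    toC `|S i j| * ((`|x 0 i| ^+ 2 + `|x 0 j| ^+ 2) / 2))).
  apply: ler_sum => j _; apply: le_trans (ler_norm_sum _ _ _) _.
  apply: ler_sum => i _; rewrite !mxE !normrM normS norm_conjC [leLHS]mulrC mulrA
    [leLHS]mulrC.
  apply: ler_wpM2l; first by rewrite lecR.
  rewrite ler_pdivlMr// mulr_natr -subr_ge0.
  have -> : `|x 0 i| ^+ 2 + `|x 0 j| ^+ 2 - `|x 0 j| * `|x 0 i| *+ 2 =
    (`|x 0 i| - `|x 0 j|) ^+ 2 by rewrite sqrrB; ring.
  by rewrite real_exprn_even_ge0// realB.
rewrite mulr_sumr.
under eq_bigr do under eq_bigr do rewrite mulrDl mulrDr.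
under eq_bigr do rewrite big_split.
(* Exchanging one of the two double sums puts [|x 0 i| ^+ 2] outside in both, next to a row sum of
   [|S|] in one and a column sum in the other. *)
rewrite big_split/= exchange_big/= -big_split/=; apply: ler_sum => i _.
rewrite -!mulr_suml -mulrDl.
have le1 : \sum_j toC `|S i j| <= toC C by rewrite -rmorph_sum lecR.
have le2 : \sum_j toC `|S j i| <= toC C.
  rewrite (eq_bigr (fun j => toC `|S i j|))// => j _.
  by rewrite -[in LHS]Ssym mxE.
have -> : toC C * `|x 0 i| ^+ 2 = (toC C + toC C) * (`|x 0 i| ^+ 2 / 2) by field.
by apply: ler_wpM2r; [rewrite divr_ge0// exprn_ge0 | exact: lerD].
Qed.

End complexified.

(** * Counting eigenvalues of real symmetric matrices *)

Section eigenvalue_counting.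
Local Open Scope sesquilinear_scope.
Variable R : realType.
Local Notation toC := (real_complex R).

(** Each multiplicity is the number of indices [i] with [D 0 i = l]; exchanging the two sums counts
    every index once, at its own eigenvalue. *)
Lemma eigen_count_spectral (k : nat) (M : 'M[R]_k) (P : 'M[R[i]]_k)
    (D : 'rV[R]_k) (A : set R) : P \is unitarymx ->
  map_mx toC M = invmx P *m diag_mx (map_mx toC D) *m P ->
  eigen_count M A = #|[set i | D 0 i \in A]%SET|.
Proof.
move=> Pu ME; have rkE l := mxrank_eigenspace_spectral _ _ _ _ _ l Pu ME.
have Dl i : \rank (eigenspace M (D 0 i)) != 0%N.
  by rewrite rkE -lt0n; apply/card_gt0P; exists i; rewrite inE.
rewrite /eigen_count; set F := fun l => \rank (eigenspace M l).
set B := [set l | _].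
(* A sum over a set has the default value zero when its support is infinite, so finiteness comes
   first: the support lies in the range of [D 0]. *)
have fin : finite_set (B `&` F @^-1` [set~ 0%N]).
  apply: (@sub_finite_set _ _ (range (D 0))); last exact/finite_image/finite_finset.
  move=> l [_]; rewrite /F/= rkE => /eqP; rewrite -lt0n => /card_gt0P[ i ].
  by rewrite inE => /eqP <-; exists i.
have memE i : (D 0 i \in finite_support 0%N B F) = (D 0 i \in A).
  rewrite in_finite_support//; apply/idP/idP; rewrite !inE.
    by move=> [[]].
  move=> DA; split; last exact/eqP/Dl.
  by split => //; rewrite /eigenvalue -mxrank_eq0 Dl.
rewrite (eq_bigr (fun l => \sum_(i < k) (D 0%R i == l : nat))%N); last first.
  by move=> l _; rewrite rkE -sum1dep_card big_mkcond.
rewrite exchange_big/= -sum1dep_card [RHS]big_mkcond; apply: eq_bigr => i _.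
rewrite -[LHS]big_mkcond/= sum1_count.
rewrite (eq_count (a2 := pred1 (D 0 i))); last by move=> l /=; rewrite eq_sym.
by rewrite count_uniq_mem ?finite_support_uniq // memE; case: ifP.
Qed.

(** The same [P] diagonalises [- M], with diagonal [- D]. This reduces counts above [E] to counts
    below [- E]. *)
Lemma eigen_count_opp (k : nat) (M : 'M[R]_k) (A : set R) : M^T = M ->
  eigen_count (- M) A = eigen_count M (-%R @^-1` A).
Proof.
move=> /symmetric_spectral[P [D [Pu ME]]].
have NME : map_mx toC (- M) = invmx P *m diag_mx (map_mx toC (- D)) *m P.
  by rewrite !map_mxN ME linearN/= mulmxN mulNmx.
apply: etrans (eigen_count_spectral _ _ _ _ A Pu NME) _.
apply: etrans _ (esym (eigen_count_spectral _ _ _ _ (-%R @^-1` A) Pu ME)).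
by apply: eq_card => i; rewrite !inE !mxE.
Qed.

(* Courant-Fischer by dimension count: too many eigenvalues on one side of [E]
   would give a nonzero combination of their eigenvectors supported on sites
   where [v] forces the quadratic form to the other side. *)
Lemma eigen_count_perturbation (k : nat) (S : 'M[R]_k) (v : 'rV[R]_k) (C E : R) :
  S^T = S -> (forall i, \sum_j `|S i j| <= C) ->
  (#|[set i | (v 0 i <= E - C)%R]%SET| <=
     eigen_count (S + diag_mx v)%R [set l | (l <= E)%R] <=
   #|[set i | (v 0 i <= E + C)%R]%SET|)%N.
Proof.
move=> Ssym SC; have Msym : (S + diag_mx v)^T = S + diag_mx v.
  by rewrite linearD/= Ssym tr_diag_mx.
have [P [D [Pu ME]]] := symmetric_spectral _ _ _ Msym.
rewrite (eigen_count_spectral _ _ _ _ _ Pu ME).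
have -> : [set i | D 0 i \in [set l : R | l <= E]%classic]%SET =
    [set i | D 0 i <= E]%SET.
  by apply/setP => i; rewrite 2!finset.inE; apply/idP/idP; rewrite inE.
have Pinv := unitarymx_unit Pu.
(* Here [c] holds eigenbasis coordinates and [x] site coordinates. The form of [S + diag_mx v] is
   diagonal in the former and that of [diag_mx v] in the latter; their difference is the form of
   [S], which [bound] keeps within [C] times the squared norm. *)
have formE (c : 'rV[R[i]]_k) (x := c *m P) :
    (x *m map_mx toC S *m x^t*) 0 0 =
    \sum_i toC (D 0 i) * `|c 0 i| ^+ 2 - \sum_i toC (v 0 i) * `|x 0 i| ^+ 2.
  apply/eqP; rewrite eq_sym subr_eq -!mulmx_diag_adj; apply/eqP.
  have -> : (c *m diag_mx (map_mx toC D) *m c ^t*) =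
      x *m map_mx toC (S + diag_mx v) *m x^t*.
    rewrite ME /x trmx_mul map_mxM -invmx_unitary// !mulmxA.
    by rewrite (mulmxK Pinv) -[_ *m P *m _](mulmxA _ P) (mulmxV Pinv) mulmx1.
  by rewrite map_mxD map_diag_mx mulmxDr mulmxDl mxE.
have realD (w : 'rV[R]_k) (y : 'rV[R[i]]_k) :
    \sum_i toC (w 0 i) * `|y 0 i| ^+ 2 \is Num.real.
  apply: sum_real => i _; apply: realM; last by rewrite realX.
  by apply/complex_realP; exists (w 0 i).
have sumE (t : R) (y : 'rV[R[i]]_k) :
    \sum_i toC t * `|y 0 i| ^+ 2 = toC t * \sum_i `|y 0 i| ^+ 2.
  by rewrite mulr_sumr.
have lt_sum (t : R) (w : 'rV[R]_k) (x : 'rV[R[i]]_k) : x != 0 ->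
    (forall i, x 0 i != 0 -> t < w 0 i) ->
    toC t * \sum_i `|x 0 i| ^+ 2 < \sum_i toC (w 0 i) * `|x 0 i| ^+ 2.
  move=> /rV0Pn[j xj] tw; rewrite -sumE (bigD1 j)//= [ltRHS](bigD1 j)//=.
  apply: ltr_leD; first by rewrite ltr_pM2r ?ltcR ?tw// exprn_gt0// normr_gt0.
  apply: ler_sum => i _; have [->|xi] := eqVneq (x 0 i) 0.
    by rewrite normr0 expr0n/= !mulr0.
  by rewrite ler_wpM2r ?exprn_ge0// lecR ltW// tw.
have le_sum (t : R) (w : 'rV[R]_k) (y : 'rV[R[i]]_k) :
    (forall i, y 0 i != 0 -> w 0 i <= t) ->
    \sum_i toC (w 0 i) * `|y 0 i| ^+ 2 <= toC t * \sum_i `|y 0 i| ^+ 2.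
  move=> wt; rewrite -sumE; apply: ler_sum => i _.
  have [->|yi] := eqVneq (y 0 i) 0; first by rewrite normr0 expr0n/= !mulr0.
  by rewrite ler_wpM2r ?exprn_ge0// lecR wt.
have bound (c : 'rV[R[i]]_k) (x := c *m P) :
    - (toC C * \sum_i `|x 0 i| ^+ 2) <=
    \sum_i toC (D 0 i) * `|c 0 i| ^+ 2 - \sum_i toC (v 0 i) * `|x 0 i| ^+ 2
    <= toC C * \sum_i `|x 0 i| ^+ 2.
  rewrite -real_ler_norml ?realB//.
  by have := norm_quadratic_le _ _ _ _ x Ssym SC; rewrite formE.
apply/andP; split; rewrite leqNgt; apply/negP => card_lt.
(* Too few eigenvalues at most [E]: take [c] on eigenvalues above [E] with [x] living on sites where
   [v <= E - C]. The form of [S] then exceeds [C] times the squared norm. *)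
- have [|c [x0 cS xS]] := @exists_row_of_card_lt _ _ P
    (~: [set i | D 0 i <= E])%SET
    (~: [set i | v 0 i <= E - C])%SET Pinv.
    by rewrite -(ltn_add2l #|[set i | v 0 i <= E - C]%SET|) cardsC
      -(cardsC [set i | D 0 i <= E]%SET) ltn_add2r.
  have c0 : c != 0 by apply: contra_neq x0 => ->; rewrite mul0mx.
  have vx : - (toC (E - C) * \sum_i `|(c *m P) 0 i| ^+ 2) <=
      - \sum_i toC (v 0 i) * `|(c *m P) 0 i| ^+ 2.
    rewrite lerN2; apply: le_sum => i; apply: contraR => vi; apply/eqP/xS.
    by rewrite !inE.
  have Dc : toC E * \sum_i `|(c *m P) 0 i| ^+ 2 <
      \sum_i toC (D 0 i) * `|c 0 i| ^+ 2.
    rewrite (unitary_norm _ _ _ _ Pu); apply: lt_sum => // i ci.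
    rewrite ltNge; apply: contra ci => Di; apply/eqP/cS.
    by rewrite !inE negbK.
  have /andP[_ /(lt_le_trans (ltr_leD Dc vx))] := bound c.
  by rewrite -mulrBl -rmorphB opprB addrC subrK ltxx.
(* Too many eigenvalues at most [E]: take [c] on those eigenvalues with [x] living on sites where
   [v > E + C]. The form of [S] then falls below [- C] times the squared norm. *)
- have [c [x0 cS xS]] := exists_row_of_card_lt _ _ _ _ _ Pinv card_lt.
  have vx : - \sum_i toC (v 0 i) * `|(c *m P) 0 i| ^+ 2 <
      - (toC (E + C) * \sum_i `|(c *m P) 0 i| ^+ 2).
    rewrite ltrN2; apply: lt_sum => // i; apply: contra_neqT.
    rewrite -leNgt => vi; apply/xS.
    by rewrite !inE.
  have Dc : \sum_i toC (D 0 i) * `|c 0 i| ^+ 2 <=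
      toC E * \sum_i `|(c *m P) 0 i| ^+ 2.
    rewrite (unitary_norm _ _ _ _ Pu); apply: le_sum => i.
    by apply: contraR => Di; apply/eqP/cS; rewrite !inE.
  have /andP[/le_lt_trans/(_ (ler_ltD Dc vx))] := bound c.
  by rewrite -mulrBl -rmorphB opprD addNKr rmorphN mulNr ltxx.
Qed.

End eigenvalue_counting.

(** * Truncated Schroedinger operators *)

Section lattice.
Variables (R : realType) (d : nat).
Implicit Types (n m : 'rV[int]_d) (v : 'rV[int]_d -> R).

Lemma enormN n : enorm R (- n) = enorm R n.
Proof.
by congr Num.sqrt; apply: eq_bigr => i _; rewrite mxE rmorphN sqrrN.
Qed.

(** The squares of the coordinates are nonnegative integers with sum 1, so a nonzero coordinate
    takes the whole sum and the others vanish. *)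
Lemma enorm_eq1 n : enorm R n = 1 ->
  exists i, n = delta_mx 0 i \/ n = - delta_mx 0 i.
Proof.
move=> n1; have s1 : \sum_i (n 0 i) ^+ 2 = 1.
  apply: (@intr_inj R); transitivity (enorm R n ^+ 2); last by rewrite n1 expr1n.
  rewrite sqr_sqrtr; last by apply: sumr_ge0 => i _; exact: sqr_ge0.
  by rewrite rmorph_sum/=; apply: eq_bigr => i _; rewrite rmorphXn.
have [i ni] : exists i, n 0 i != 0.
  apply/existsP; apply: contra_eqT s1; rewrite negb_exists => /forallP n0.
  by rewrite big1// => i _; have := n0 i; rewrite negbK => /eqP ->.
exists i; have ni1 : 1 <= n 0 i ^+ 2 by rewrite -gtz0_ge1 exprn_even_gt0.
move: s1; rewrite (bigD1 i)//= => s1.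
have rest0 : \sum_(j < d | j != i) n 0 j ^+ 2 = 0.
  apply/eqP; rewrite eq_le sumr_ge0 ?andbT; last by move=> j _; exact: sqr_ge0.
  by rewrite -(lerD2l (n 0 i ^+ 2)) s1 addr0.
have nj j : j != i -> n 0 j = 0.
  move=> ji; apply/eqP; rewrite -sqrf_eq0; apply/eqP; move: rest0.
  by move=> /psumr_eq0P -> // k _; exact: sqr_ge0.
move: s1; rewrite rest0 addr0 => /eqP; rewrite sqrf_eq1 => /orP[] /eqP ni1'.
  left; apply/rowP => j; rewrite !mxE eqxx/=.
  by have [->|/nj] := eqVneq j i; [rewrite ni1'|].
right; apply/rowP => j; rewrite !mxE eqxx/=.
by have [->|/nj ->] := eqVneq j i; [rewrite ni1'| rewrite oppr0].
Qed.

(** All neighbours of [n] are among the [2 * d] sites obtained by adding or subtracting a basis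
    vector, and [A] contains each of them at most once. *)
Lemma card_neighbors (n : 'rV[int]_d) (A : {fset 'rV[int]_d}) :
  (\sum_(m <- A) (enorm R (m - n) == 1)%R <= 2 * d)%N.
Proof.
pose B : seq 'rV[int]_d :=
  [seq n + delta_mx 0 i | i : 'I_d] ++ [seq n - delta_mx 0 i | i : 'I_d].
have -> : (2 * d = size B)%N.
  by rewrite size_cat !size_map -enumT size_enum_ord mul2n addnn.
rewrite -big_mkcond/= sum1_count -size_filter; apply: uniq_leq_size.
  by rewrite filter_uniq// fset_uniq.
move=> m; rewrite mem_filter => /andP[/eqP /enorm_eq1[i mi] _].
rewrite mem_cat; apply/orP; have -> : m = n + (m - n) by rewrite addrC subrK.
by case: mi => ->; [left|right]; apply: map_f; rewrite mem_enum.
Qed.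

Lemma laplacian_basis_vec n m :
  laplacian (basis_vec m : _ -> R) n = (enorm R (m - n) == 1)%:R.
Proof.
rewrite /laplacian fsbig_mkcond (fsbigTE [fset m]%fset); last first.
  move=> k; rewrite inE => km; rewrite patchE/basis_vec (negbTE km).
  by case: ifP.
rewrite big_seq_fset1 patchE /basis_vec eqxx; case: ifPn.
  by rewrite inE/= => ->; rewrite eqxx.
by rewrite notin_setE/=; case: eqP.
Qed.

Definition adjacency_mx (L : nat) : 'M[R]_(#|` Lambda d L|) :=
  \matrix_(i, j) (enorm R (nth 0 (Lambda d L) j - nth 0 (Lambda d L) i) == 1)%:R.

Lemma adjacency_sym L : (adjacency_mx L)^T = adjacency_mx L.
Proof. by apply/matrixP => i j; rewrite !mxE -enormN opprB. Qed.

Lemma adjacency_row_sum L i : \sum_j `|adjacency_mx L i j| <= 2 * d%:R.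
Proof.
rewrite -natrM; under eq_bigr do rewrite mxE normr_nat.
rewrite -natr_sum ler_nat.
apply: leq_trans (card_neighbors (nth 0 (Lambda d L) i) (Lambda d L)).
by rewrite [leqRHS](big_nth 0) big_mkord.
Qed.

Lemma schrodinger_mxE v L :
  schrodinger_mx v L =
  - adjacency_mx L + diag_mx (\row_i v (nth 0 (Lambda d L) i)).
Proof.
apply/matrixP => i j; rewrite !mxE /schrodinger laplacian_basis_vec.
congr (_ + _); rewrite /basis_vec nth_uniq ?fset_uniq//.
by rewrite mulr_natr; congr (_ *+ _).
Qed.

Lemma card_Lambda (Q : pred 'rV[int]_d) L :
  #|[set i : 'I_(#|` Lambda d L|) | Q (nth 0 (Lambda d L) i)]%SET| =
  (\sum_(n <- Lambda d L) Q n)%N.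
Proof. by rewrite -sum1dep_card big_mkcond (big_nth 0) big_mkord. Qed.

Lemma eigen_count_le_bounds v L (E : R) :
  (\sum_(n <- Lambda d L) (v n <= E - 2 * d%:R)%R <= eigen_count_le v L E <=
   \sum_(n <- Lambda d L) (v n <= E + 2 * d%:R)%R)%N.
Proof.
rewrite -!(card_Lambda (fun n => v n <= _)) /eigen_count_le schrodinger_mxE.
have := @eigen_count_perturbation _ _ (- adjacency_mx L)
  (\row_i v (nth 0 (Lambda d L) i)) (2 * d%:R) E.
under eq_finset do rewrite mxE.
under [X in (_ <= _ <= #|pred_of_set X|)%N]eq_finset do rewrite mxE.
apply; first by rewrite linearN/= adjacency_sym.
move=> i; apply: le_trans (adjacency_row_sum _ i).
by apply: ler_sum => j _; rewrite mxE normrN.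
Qed.

Lemma eigen_count_ge_bounds v L (E : R) :
  (\sum_(n <- Lambda d L) (E + 2 * d%:R <= v n)%R <= eigen_count_ge v L E <=
   \sum_(n <- Lambda d L) (E - 2 * d%:R <= v n)%R)%N.
Proof.
rewrite -!(card_Lambda (fun n => _ <= v n)) /eigen_count_ge.
pose v' : 'rV[R]_(#|` Lambda d L|) := \row_i (- v (nth 0 (Lambda d L) i)).
have -> : schrodinger_mx v L = - (adjacency_mx L + diag_mx v').
  rewrite schrodinger_mxE opprD; congr (_ + _).
  by apply/matrixP => i j; rewrite !mxE -mulNrn opprK.
rewrite eigen_count_opp; last first.
  by rewrite linearD/= adjacency_sym tr_diag_mx.
have -> : -%R @^-1` [set l | E <= l] = [set l | l <= - E].
  by apply/seteqP; split => l /=; rewrite lerNr.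
have := @eigen_count_perturbation _ _ (adjacency_mx L)
  v' (2 * d%:R) (- E) (adjacency_sym L) (adjacency_row_sum L).
under eq_finset do rewrite mxE -opprD lerN2.
by under [X in (_ <= _ <= #|pred_of_set X|)%N]eq_finset do
  rewrite mxE lerNl opprD opprK.
Qed.

End lattice.

(** * Pareto tails *)

Section pareto.
Variables (R : realType) (delta : R).
Hypothesis delta_gt1 : 1 < delta.

Lemma continuous_powRr (r x : R) : 0 < x -> {for x, continuous (fun y => y `^ r)}.
Proof.
move=> x0; apply: differentiable_continuous; apply/derivable1_diffP.
by have := is_derive1_powR r x0 => -[].
Qed.

Lemma cvg_powRN_pinfty (r : R) : 0 < r -> x `^ (- r) @[x --> +oo] --> 0.
Proof.
move=> r0; apply/cvgrPdist_le => e e0; near=> x.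
have x0 : 0 < x by near: x; exact: nbhs_pinfty_gt.
rewrite sub0r normrN ger0_norm ?powR_ge0// powRN invf_ple ?posrE ?powR_gt0//.
have ex : e^-1 `^ r^-1 <= x by near: x; exact: nbhs_pinfty_ge.
have -> : e^-1 = (e^-1 `^ r^-1) `^ r.
  by rewrite -powRrM mulVf ?gt_eqF// powRr1// invr_ge0 ltW.
by rewrite ge0_ler_powR// ?nnegrE ?powR_ge0// ltW.
Unshelve. all: by end_near. Qed.

Lemma pareto_pdf_ge1 (x : R) : 1 <= `|x| ->
  pareto_pdf delta x = (delta - 1) / 2 * `|x| `^ (- delta).
Proof. by move=> x1; rewrite /pareto_pdf ltNge x1. Qed.

Lemma integral_pareto_right (s : R) : 1 <= s ->
  (\int[lebesgue_measure]_(x in `[s, +oo[) (pareto_pdf delta x)%:E =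
   (1 / 2 * s `^ (- (delta - 1)))%:E)%E.
Proof.
move=> s1; have s0 : 0 < s by exact: lt_le_trans s1.
pose f (x : R) := (delta - 1) / 2 * x `^ (- delta).
(* The primitive of [f] that vanishes at infinity. *)
pose F (x : R) : R := - (1 / 2) * x `^ (- (delta - 1)).
have gt0s x : s <= x -> 0 < x by exact: lt_le_trans.
transitivity (\int[lebesgue_measure]_(x in `[s, +oo[) (f x)%:E)%E.
  apply: eq_integral => x; rewrite inE/= in_itv/= andbT => sx.
  have x1 : 1 <= `|x| by rewrite ger0_norm ?(le_trans s1)// ltW ?gt0s.
  by rewrite pareto_pdf_ge1// /f ger0_norm// ltW ?gt0s.
have dF (x : R) : 0 < x -> is_derive x 1 F (f x).
  move=> x0.
  have -> : f x = - (1 / 2) * (- (delta - 1) * x `^ (- (delta - 1) - 1)).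
    have -> : - (delta - 1) - 1 = - delta by lra.
    by rewrite /f; lra.
  exact: is_deriveZ (is_derive1_powR (- (delta - 1)) x0).
rewrite (@ge0_continuous_FTC2y _ f F s 0).
- by rewrite -EFinB sub0r /F mulNr opprK.
- move=> x sx; rewrite /f mulr_ge0 ?powR_ge0// divr_ge0// subr_ge0 ltW//.
- apply: continuous_in_subspaceT => x; rewrite inE/= in_itv/= andbT => /gt0s x0.
  by apply: cvgM; [exact: cvg_cst|exact: continuous_powRr].
- rewrite -[0](mulr0 (- (1 / 2))); apply: cvgM; first exact: cvg_cst.
  by apply: cvg_powRN_pinfty; rewrite subr_gt0.
- by move=> x /ltW /gt0s /dF [].
- apply: cvg_at_right_filter; apply: cvgM; first exact: cvg_cst.
  exact: continuous_powRr.
- move=> x; rewrite in_itv/= andbT => /ltW /gt0s /dF[? <-].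
  by rewrite derive1E.
Qed.

Lemma integral_pareto_left (s : R) : 1 <= s ->
  (\int[lebesgue_measure]_(x in `]-oo, (- s)%R]) (pareto_pdf delta x)%:E =
   (1 / 2 * s `^ (- (delta - 1)))%:E)%E.
Proof.
move=> s1; have s0 : 0 < s by exact: lt_le_trans s1.
(* The density jumps at [-1], so the reflection [x -> - x] is applied to this formula, which is
   continuous for negative [x] and agrees with the density on the half-line. *)
pose f (x : R) := (delta - 1) / 2 * (- x) `^ (- delta).
transitivity (\int[lebesgue_measure]_(x in `]-oo, (- s)%R]) (f x)%:E)%E.
  apply: eq_integral => x; rewrite inE/= in_itv/= => xs; have x0 : x <= 0 by lra.
  have x1 : 1 <= `|x| by rewrite ler0_norm//; lra.
  by rewrite pareto_pdf_ge1// /f ler0_norm.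
rewrite ge0_integration_by_substitutionNy; last 2 first.
- apply: continuous_in_subspaceT => x; rewrite inE/= in_itv/= => xs.
  apply: cvgM; first exact: cvg_cst.
  apply: (@continuous_comp _ _ _ -%R (fun y => y `^ (- delta))).
    exact: oppr_continuous.
  by apply: continuous_powRr; lra.
- by move=> x _; rewrite /f mulr_ge0 ?powR_ge0// divr_ge0// subr_ge0 ltW.
rewrite -integral_pareto_right//; apply: eq_integral => x.
rewrite inE/= in_itv/= andbT => sx; have nx : `|x| = x by rewrite ger0_norm//; lra.
by rewrite /= /f opprK pareto_pdf_ge1 nx//; lra.
Qed.

Section tails.
Context (disp : measure_display) (T : measurableType disp) (P : probability T R).
Variable X : {RV P >-> R}.
Hypothesis Xdensity : has_density X (pareto_pdf delta).

Lemma pareto_right_tail (s : R) : 1 <= s ->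
  P (X @^-1` `[s, +oo[) = (1 / 2 * s `^ (- (delta - 1)))%:E.
Proof.
by move=> s1; rewrite -integral_pareto_right// -Xdensity.
Qed.

Lemma pareto_left_tail (s : R) : 1 <= s ->
  P (X @^-1` `]-oo, (- s)%R]) = (1 / 2 * s `^ (- (delta - 1)))%:E.
Proof.
by move=> s1; rewrite -integral_pareto_left// -Xdensity.
Qed.

Lemma pareto_center : P (X @^-1` `]-1, 1[) = 0%E.
Proof.
apply: etrans (Xdensity _ (measurable_itv `]-1, 1[)) _.
apply: integral0_eq => x; rewrite /= in_itv/= /pareto_pdf => x1.
by rewrite ltr_norml x1.
Qed.

(** For [s <= 1] the claimed bound is at least [1 / 2]. The density vanishes on []-1, 1[], so [A]
    has no more mass than [B], namely [1 / 2]. The tail formula thus survives as an upper bound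
    below the cut-off [1]. *)
Lemma pareto_tail_le (A B : set R) (s : R) : 0 < s ->
  measurable A -> measurable B -> A `<=` `]-1, 1[ `|` B ->
  P (X @^-1` B) = (1 / 2)%:E -> s <= 1 ->
  (P (X @^-1` A) <= (1 / 2 * s `^ (- (delta - 1)))%:E)%E.
Proof.
move=> s0 mA mB AB PB s1.
have mX (C : set R) : measurable C -> measurable (X @^-1` C).
  by move=> mC; rewrite -[X in measurable X]setTI; exact: measurable_funPT.
apply: (@le_trans _ _ (P (X @^-1` (`]-1, 1[ `|` B)))).
  apply: le_measure; rewrite ?inE; first exact: mX.
    by apply: mX; exact: measurableU.
  by move=> w; exact: AB.
have PU (I J : set R) : measurable I -> measurable J ->
    (P (X @^-1` (I `|` J)) <= P (X @^-1` I) + P (X @^-1` J))%E.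
  by move=> mI mJ; rewrite preimage_setU; apply: measureU2; exact: mX.
apply: (le_trans (PU _ _ _ _)) => //; rewrite pareto_center add0e PB lee_fin.
rewrite ler_peMr// powRN invf_ge1 ?powR_gt0//.
have d0 : 0 <= delta - 1 by rewrite subr_ge0 ltW.
by have := ge0_ler_powR d0 _ _ s1; rewrite powR1; apply; rewrite nnegrE ?ltW.
Qed.

Lemma pareto_right_tail_le (s : R) : 0 < s ->
  (P (X @^-1` `[s, +oo[) <= (1 / 2 * s `^ (- (delta - 1)))%:E)%E.
Proof.
move=> s0; have [s1|/ltW s1] := leP 1 s; first by rewrite pareto_right_tail.
apply: (@pareto_tail_le _ `[1, +oo[) => //; last first.
  by rewrite pareto_right_tail// powR1 mulr1.
move=> x /=; rewrite !in_itv/= !andbT => sx.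
by have [|x1] := leP 1 x; [right|left; lra].
Qed.

Lemma pareto_left_tail_le (s : R) : 0 < s ->
  (P (X @^-1` `]-oo, (- s)%R]) <= (1 / 2 * s `^ (- (delta - 1)))%:E)%E.
Proof.
move=> s0; have [s1|/ltW s1] := leP 1 s; first by rewrite pareto_left_tail.
apply: (@pareto_tail_le _ `]-oo, -1]) => //; last first.
  by rewrite pareto_left_tail// powR1 mulr1.
move=> x /=; rewrite !in_itv/= => sx.
by have [|x1] := leP x (-1); [right|left; lra].
Qed.

End tails.
End pareto.

(** * Expectations and growth of beta *)

Lemma ler_sum_uniq_subset (R : numDomainType) (T : eqType) (s1 s2 : seq T) (f : T -> R) :
  (forall x, 0 <= f x) -> uniq s1 -> uniq s2 -> {subset s1 <= s2} ->
  \sum_(x <- s1) f x <= \sum_(x <- s2) f x.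
Proof.
move=> f0 u1 u2 s12; rewrite [leRHS](bigID (mem s1))/= -[X in _ <= X + _]big_filter.
have s1E : perm_eq [seq x <- s2 | mem s1 x] s1; last first.
  by rewrite (perm_big _ s1E) lerDl sumr_ge0.
apply: uniq_perm => //; first exact: filter_uniq.
by move=> x; rewrite mem_filter/=; apply/andP/idP => [[]|x1]//; split=> //; exact: s12.
Qed.

Section expectation.
Context (disp : measure_display) (T : measurableType disp) (R : realType)
  (P : probability T R).

(* The integral of a nonnegative function is a supremum over simple functions,
   so monotonicity holds without measurability; this spares us the
   measurability of the eigenvalue counts. *)
Lemma le_expectation (X Y : T -> R) : (forall w, 0 <= X w) ->
  (forall w, X w <= Y w) -> ('E_P[X] <= 'E_P[Y])%E.
Proof.
move=> X0 XY; rewrite unlock !ge0_integralTE//; last first.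
  by move=> w; rewrite lee_fin (le_trans (X0 w)).
apply: ereal_sup_le => _ [h /= hX <-]; exists h => //= w.
by rewrite (le_trans (hX w))// lee_fin.
Qed.

Lemma expectation_count (I : choiceType) (s : seq I) (f : I -> T -> bool) :
  (forall i, measurable [set w | f i w]) ->
  ('E_P[fun w => (\sum_(i <- s) f i w)%N%:R] =
   \sum_(i <- s) P [set w | f i w])%E.
Proof.
move=> mf; rewrite unlock.
under eq_integral do rewrite natr_sum -sumEFin.
have fE i : (fun w => (f i w)%:R%:E) = EFin \o \1_[set w | f i w] :> (T -> \bar R).
  by apply/funext => w; rewrite /= indicE; congr (_%:R%:E); rewrite mem_setE.
rewrite ge0_integral_sum//.
- apply: eq_bigr => i _; rewrite fE integral_indic// setIT//.
- move=> i; rewrite fE; apply/measurable_EFinP.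
  exact: measurable_indic.
Qed.

End expectation.

(** * Decay of the coefficients and divergence of [beta] *)

Section decay.
Variables (R : realType) (d : nat).
Implicit Types n : 'rV[int]_d.

Lemma enorm_coord n i : `|(n 0 i)%:~R| <= enorm R n.
Proof.
rewrite -sqrtr_sqr ler_wsqrtr// (bigD1 i)//= lerDl sumr_ge0// => j _.
exact: sqr_ge0.
Qed.

(** The coordinate bounds give [sqrt d * L]; the cruder factor [d], from [d <= d ^ 2], suffices and
    avoids a root. *)
Lemma enorm_box n L : box d L n -> enorm R n <= d%:R * L%:R.
Proof.
move=> nL; rewrite -[leRHS]ger0_norm ?mulr_ge0// -sqrtr_sqr ler_wsqrtr//.
apply: (@le_trans _ _ (\sum_(i < d) L%:R ^+ 2)).
  apply: ler_sum => i _; rewrite -[leLHS]ger0_norm ?sqr_ge0// normrX.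
  rewrite lerXn2r ?nnegrE// -intr_norm -[L%:R]/(L%:Z%:~R) ler_int.
  exact: nL.
rewrite sumr_const card_ord -[leLHS]mulr_natl exprMn ler_wpM2r ?sqr_ge0//.
by rewrite -natrX ler_nat; case: (d) => // k; rewrite expnS expn1 leq_pmulr.
Qed.

Lemma enorm_notin_box n L : ~ box d L n -> L%:R < enorm R n.
Proof.
move=> /existsNP[ i ] /negP; rewrite -ltNge => Li.
apply: lt_le_trans (enorm_coord n i).
by rewrite -intr_norm -[L%:R]/(L%:Z%:~R) ltr_int.
Qed.

Variables (alpha : R) (a : 'rV[int]_d -> R).
Hypothesis alpha_gt0 : 0 < alpha.
Hypothesis a_gt0 : forall n, 0 < a n.

Lemma decay_le (c2 t : R) : 0 < t -> 0 < c2 ->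
  (forall n, n != 0 -> a n <= c2 * enorm R n `^ (- alpha)) ->
  exists M : nat, forall n, n \notin Lambda d M -> a n <= t.
Proof.
move=> t0 c0 ac.
have [A [_ Abig]] : \forall x \near +oo, x `^ (- alpha) < t / c2.
  apply: (cvgr_lt 0); last by rewrite divr_gt0.
  exact: cvg_powRN_pinfty.
(* Outside this box the norm is greater than [A], beyond which [c2 * x ^ (- alpha)] is below [t]. *)
exists (Num.truncn A).+1 => n nM.
have /enorm_notin_box nA : ~ box d (Num.truncn A).+1 n.
  by move=> nbox; move/negP: nM; apply; rewrite in_Lambda; apply/forallP.
(* The decay bound excludes the origin, which lies in every box. *)
have n0 : n != 0.
  by apply: contraNneq nM => ->; rewrite in_Lambda; apply/forallP => i; rewrite mxE.
apply: le_trans (ac _ n0) _; rewrite -ler_pdivlMl// mulrC ltW//; apply: Abig.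
exact: lt_trans (Num.Theory.truncnS_gt A) nA.
Qed.

(* The [L ^ d] sites with all coordinates in [1, L] already contribute a constant
   multiple of [L ^ (d - alpha (delta - 1))] to [beta]. *)
Lemma beta_inv_cvg0 (delta c1 : R) : (0 < d)%N -> 1 < delta ->
  0 < d%:R - alpha * (delta - 1) -> 0 < c1 ->
  (forall n, n != 0 -> c1 * enorm R n `^ (- alpha) <= a n) ->
  (beta a delta L)^-1 @[L --> \oo] --> 0.
Proof.
move=> d0 delta1 sub c0 ac; set r := delta - 1.
have r0 : 0 < r by rewrite subr_gt0.
(* The selected sites have norm at most [d * L], so [a n ^ r] is at least
   [(c1 * (d * L) ^ (- alpha)) ^ r], that is [C * L ^ (- alpha * r)]. *)
pose C := c1 `^ r * d%:R `^ (- (alpha * r)).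
have C0 : 0 < C by rewrite mulr_gt0// powR_gt0// ltr0n.
have betaC (L : nat) : (0 < L)%N -> C * L%:R `^ (d%:R - alpha * r) <= beta a delta L.
  move=> L0; pose g (x : 'rV['I_L]_d) : 'rV[int]_d :=
    map_mx (fun k : 'I_L => (k.+1)%:Z) x.
  have ginj : injective g.
    move=> x y /rowP xy; apply/rowP => i; have := xy i; rewrite !mxE => -[].
    exact: ord_inj.
  have gL x : g x \in Lambda d L.
    by rewrite in_Lambda; apply/forallP => i; rewrite mxE lez_nat ltn_ord.
  have gn0 x : g x != 0.
    apply/negP => /eqP/rowP/(_ (Ordinal d0)); by rewrite !mxE.
  apply: (@le_trans _ _
    (\sum_(n <- [seq g x | x : 'rV['I_L]_d]) a n `^ r)); last first.
    apply: ler_sum_uniq_subset.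
    - by move=> n; exact: powR_ge0.
    - by rewrite map_inj_uniq ?enum_uniq.
    - exact: fset_uniq.
    - by move=> _ /mapP[x _ ->].
  rewrite big_map big_enum/=.
  apply: (@le_trans _ _ (\sum_(x : 'rV['I_L]_d) C * L%:R `^ (- (alpha * r)))).
    (* The [L ^ d] equal terms raise the exponent [- alpha * r] to [d - alpha * r]. *)
    rewrite sumr_const card_mx card_ord mul1n -[leRHS]mulr_natr -mulrA natrX.
    rewrite -powR_mulrn// -powRD; last by rewrite pnatr_eq0 -lt0n L0 implybT.
    by rewrite addrC.
  apply: ler_sum => x _.
  have gx0 : 0 < enorm R (g x).
    apply: lt_le_trans (enorm_coord _ (Ordinal d0)).
    by rewrite mxE normr_gt0 intr_eq0.
  apply: (@le_trans _ _ ((c1 * enorm R (g x) `^ (- alpha)) `^ r)); last first.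
    apply: ge0_ler_powR (ac _ (gn0 x)); first exact: ltW.
    - by rewrite nnegrE mulr_ge0 ?powR_ge0 ?ltW.
    - by rewrite nnegrE ltW.
  rewrite powRM ?powR_ge0 ?(ltW c0)// /C -mulrA -powRrM mulNr ler_pM2l ?powR_gt0//.
  rewrite -powRM// !powRN lef_pV2 ?posrE ?powR_gt0 ?mulr_gt0 ?ltr0n//.
  have gxL : enorm R (g x) <= d%:R * L%:R.
    by apply: enorm_box; have := gL x; rewrite in_Lambda => /forallP.
  apply: ge0_ler_powR gxL; first by rewrite mulr_ge0 ?ltW.
  - by rewrite nnegrE ltW.
  - by rewrite nnegrE mulr_ge0.
have lim0 : C^-1 * L%:R `^ (- (d%:R - alpha * r)) @[L --> \oo] --> (0 : R).
  rewrite -[X in _ --> X](mulr0 C^-1); apply: cvgMl_tmp.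
  apply: (cvg_comp (fun L : nat => L%:R : R)
    (fun x => x `^ (- (d%:R - alpha * r))) cvgr_idn).
  exact: cvg_powRN_pinfty.
apply: (squeeze_cvgr _ (cvg_cst 0) lim0); near=> L.
have L0 : (0 < L)%N by near: L; exact: nbhs_infty_gt.
have CL : 0 < C * L%:R `^ (d%:R - alpha * r) by rewrite mulr_gt0// powR_gt0// ltr0n.
have b0 : 0 < beta a delta L by exact: lt_le_trans (betaC _ L0).
rewrite invr_ge0 ltW//= powRN -invfM lef_pV2 ?posrE//; exact: betaC.
Unshelve. all: by end_near. Qed.

(** The origin lies in every box and contributes a positive term, so dividing by [beta] is
    legitimate for all [L], including [L = 0]. *)
Lemma beta_gt0 (delta : R) L : 0 < beta a delta L.
Proof.
have z : 0 \in Lambda d L.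
  by rewrite in_Lambda; apply/forallP => i; rewrite mxE.
rewrite /beta (big_fsetD1 0)//= ltr_wpDr ?powR_gt0//.
by apply: sumr_ge0 => n _; exact: powR_ge0.
Qed.

End decay.

(** * Limits *)

Section limits.
Variable R : realType.
Local Open Scope ereal_scope.

Lemma le_limn_esup (u v : nat -> \bar R) : (forall n, u n <= v n) ->
  limn_esup u <= limn_esup v.
Proof.
move=> uv; rewrite !limn_esup_lim; apply: lee_lim; [exact: is_cvg_esups..|].
apply: nearW => n; apply: ge_ereal_sup => _ [m nm <-].
by apply: (le_trans (uv m)); apply: ereal_sup_ubound; exists m.
Qed.

Lemma le_limn_einf (u v : nat -> \bar R) : (forall n, u n <= v n) ->
  limn_einf u <= limn_einf v.
Proof.
by move=> uv; rewrite leeN2; apply: le_limn_esup => n; rewrite leeN2.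
Qed.

Lemma limn_esup_le (u : nat -> \bar R) (l : \bar R) : (forall n, u n <= l) ->
  limn_esup u <= l.
Proof.
move=> ul; apply: le_trans (le_limn_esup _ (fun=> l) ul) _.
by have [_ ->] := @cvg_limn_einf_sup _ (fun=> l) l (cvg_cst l).
Qed.

Lemma le_limn_einf_cvg (u : nat -> \bar R) (v : nat -> R) (l : R) :
  (forall n, (v n)%:E <= u n) -> v n @[n --> \oo] --> l ->
  l%:E <= limn_einf u.
Proof.
move=> vu vl; apply: le_trans (le_limn_einf _ _ vu).
have vlE : (v n)%:E @[n --> \oo] --> l%:E by apply: cvg_EFin vl; exact: nearW.
by have [-> _] := cvg_limn_einf_sup vlE.
Qed.

End limits.

(** * Expected site counts and passage to the limit, for both spectral edges at once *)

Section expected_counts.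
Context (R : realType) (disp : measure_display) (T : measurableType disp)
  (P : probability T R) (d : nat).
Variables (a : 'rV[int]_d -> R) (delta : R).
(* [hit t n w] stands for [V w n <= - t] or for [t <= V w n]. *)
Variables (hit : R -> 'rV[int]_d -> T -> bool).
Let c (t : R) : R := 1 / 2 * (1 / t `^ (delta - 1)).

Hypothesis hit_measurable : forall t n, measurable [set w | hit t n w].
Hypothesis hit_le : forall t n, 0 < t ->
  (P [set w | hit t n w] <= (c t * a n `^ (delta - 1))%:E)%E.
Hypothesis hit_eq : forall t n, 0 < t -> a n <= t ->
  P [set w | hit t n w] = (c t * a n `^ (delta - 1))%:E.
Hypothesis beta_inv : (beta a delta L)^-1 @[L --> \oo] --> 0.
Hypothesis decay : forall t, 0 < t ->
  exists M : nat, forall n, n \notin Lambda d M -> a n <= t.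
Hypothesis beta_pos : forall L, 0 < beta a delta L.

Lemma expected_hits_le (t : R) L : 0 < t ->
  ('E_P[fun w => (\sum_(n <- Lambda d L) hit t n w)%N%:R] <=
   (c t * beta a delta L)%:E)%E.
Proof.
move=> t0; rewrite expectation_count// mulr_sumr -sumEFin.
by apply: lee_sum => n _; exact: hit_le.
Qed.

(** The hitting probability is exact outside the box [M] given by [decay]. Discarding the sites
    inside it costs at most their share of [beta], so [K] is [beta] of that fixed box and does not
    depend on [L]. *)
Lemma expected_hits_ge (t : R) : 0 < t -> exists K : R, forall L,
  ((c t * (beta a delta L - K))%:E <=
   'E_P[fun w => (\sum_(n <- Lambda d L) hit t n w)%N%:R])%E.
Proof.
move=> t0; have [M aM] := decay _ t0; exists (beta a delta M) => L.
have c0 : 0 <= c t by rewrite mulr_ge0 ?divr_ge0 ?powR_ge0.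
rewrite expectation_count//.
apply: (@le_trans _ _
    (\sum_(n <- Lambda d L | n \notin Lambda d M) P [set w | hit t n w])%E).
  rewrite (eq_bigr (fun n => (c t * a n `^ (delta - 1))%:E)); last first.
    by move=> n /aM; exact: hit_eq.
  rewrite sumEFin lee_fin -mulr_sumr ler_wpM2l// lerBlDr.
  (* The discarded part runs over the sites common to both boxes, hence is at most [beta a delta M]
     even when [L < M]. *)
  rewrite {1}/beta (bigID (fun n => n \in Lambda d M))/= addrC lerD2l -big_filter.
  apply: ler_sum_uniq_subset; rewrite ?filter_uniq ?fset_uniq//.
    by move=> n; exact: powR_ge0.
  by move=> n; rewrite mem_filter => /andP[].
by rewrite [leRHS](bigID (fun n => n \in Lambda d M))/= leeDr// sume_ge0.
Qed.

(** The upper bound already holds for each [L]. In the lower bound the defect [c t2 * K], once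
    divided by [beta], tends to zero because [beta] diverges. *)
Lemma limits_of_sandwich (N : nat -> T -> nat) (t1 t2 : R) : 0 < t1 -> 0 < t2 ->
  (forall L w, (\sum_(n <- Lambda d L) hit t2 n w <= N L w <=
                \sum_(n <- Lambda d L) hit t1 n w)%N) ->
  let u := fun L : nat => (((beta a delta L)^-1)%:E *
    'E_P[fun w => (N L w)%:R])%E in
  [/\ ((c t2)%:E <= limn_einf u)%E, (limn_einf u <= limn_esup u)%E &
      (limn_esup u <= (c t1)%:E)%E].
Proof.
move=> t10 t20 hN u; split; last 1 first.
- apply: limn_esup_le => L; rewrite /u.
  rewrite muleC lee_pdivrMr ?beta_pos// -EFinM.
  apply: le_trans (expected_hits_le _ L t10); apply: le_expectation => // w.
  by rewrite ler_nat; case/andP: (hN L w).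
- have [K hK] := expected_hits_ge _ t20.
  apply: (@le_limn_einf_cvg _ _ (fun L => c t2 * (1 - K * (beta a delta L)^-1))).
    move=> L; rewrite /u muleC lee_pdivlMr ?beta_pos// -EFinM.
    have -> : c t2 * (1 - K / beta a delta L) * beta a delta L =
      c t2 * (beta a delta L - K).
      by rewrite -mulrA [(1 - _) * _]mulrBl mul1r divfK ?gt_eqF.
    apply: (le_trans (hK L)); apply: le_expectation => // w.
    by rewrite ler_nat; case/andP: (hN L w).
  have lim : c t2 * (1 - K / beta a delta L) @[L --> \oo] --> c t2 * (1 - K * 0).
    by apply: cvgMl_tmp; apply: cvgB; [exact: cvg_cst|exact: cvgMl_tmp].
  by rewrite mulr0 subr0 mulr1 in lim.
- exact: limn_einf_sup.
Qed.

End expected_counts.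

Theorem theorem1p4 (R : realType) (disp : measure_display)
  (Omega : measurableType disp) (P : probability Omega R)
  (d : nat) (d_gt0 : (0 < d)%N)
  (alpha delta : R) (alpha_gt0 : 0 < alpha) (delta_gt1 : 1 < delta)
  (subcritical : 0 < d%:R - alpha * (delta - 1))
  (q : 'rV[int]_d -> {RV P >-> R})
  (q_indep : mutually_independent q)
  (q_density : forall n, has_density (q n) (pareto_pdf delta))
  (a : 'rV[int]_d -> R) (a_gt0 : forall n, 0 < a n)
  (a_decay : exists c1 c2 : R, [/\ 0 < c1, c1 <= c2 &
    forall n, n != 0 ->
      c1 * enorm R n `^ (- alpha) <= a n <= c2 * enorm R n `^ (- alpha)]) :
  let V := fun (w : Omega) (n : 'rV[int]_d) => a n * q n w in
  (forall E eps : R, E < - (2 * d%:R) -> eps = - (2 * d%:R) - E ->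
    let u := fun L : nat => (((beta a delta L)^-1)%:E *
      'E_P[fun w => (eigen_count_le (V w) L E)%:R])%E in
    [/\ ((1 / 2 * (1 / (4 * d%:R + eps) `^ (delta - 1)))%:E <= limn_einf u)%E,
        (limn_einf u <= limn_esup u)%E &
        (limn_esup u <= (1 / 2 * (1 / eps `^ (delta - 1)))%:E)%E]) /\
  (forall E eps : R, 0 < eps -> E = 2 * d%:R + eps ->
    let u := fun L : nat => (((beta a delta L)^-1)%:E *
      'E_P[fun w => (eigen_count_ge (V w) L E)%:R])%E in
    [/\ ((1 / 2 * (1 / (4 * d%:R + eps) `^ (delta - 1)))%:E <= limn_einf u)%E,
        (limn_einf u <= limn_esup u)%E &
        (limn_esup u <= (1 / 2 * (1 / eps `^ (delta - 1)))%:E)%E]).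
Proof.
move=> V; have [c1 [c2 [c1_gt0 c12 a_bounds]]] := a_decay.
have c2_gt0 : 0 < c2 by exact: lt_le_trans c12.
have beta_inv : (beta a delta L)^-1 @[L --> \oo] --> 0.
  by apply: (beta_inv_cvg0 _ _ _ _ alpha_gt0 a_gt0 _ c1) => // n /a_bounds/andP[].
have decay t : 0 < t -> exists M : nat, forall n, n \notin Lambda d M -> a n <= t.
  move=> t0; apply: (decay_le _ _ _ _ alpha_gt0 c2) => // n /a_bounds/andP[] //.
have beta_pos L : 0 < beta a delta L by exact: beta_gt0.
have d_ge0 : 0 <= d%:R :> R by [].
(* As [a n] is positive, [V w n] passes [t] exactly when [q n w] passes [t / a n]; the Pareto tail
   at [t / a n] produces the summand [a n ^ (delta - 1)] of [beta]. *)
have tailE t n : 0 < t -> 1 / 2 * (t / a n) `^ (- (delta - 1)) =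
    1 / 2 * (1 / t `^ (delta - 1)) * a n `^ (delta - 1).
  move=> t0; rewrite powRM ?invr_ge0 ?ltW// -[(a n)^-1]powR_inv1 ?ltW//.
  rewrite -powRrM mulN1r opprK powRN; lra.
have leE t n w : (V w n <= - t) = (q n w <= - (t / a n)).
  by rewrite /V -mulNr ler_pdivlMr// mulrC.
have geE t n w : (t <= V w n) = (t / a n <= q n w).
  by rewrite /V ler_pdivrMr// mulrC.
have left_setE t n : [set w | V w n <= - t] = q n @^-1` `]-oo, (- (t / a n))%R].
  by apply/seteqP; split => w /=; rewrite in_itv/= leE.
have right_setE t n : [set w | t <= V w n] = q n @^-1` `[(t / a n)%R, +oo[.
  by apply/seteqP; split => w /=; rewrite in_itv/= andbT geE.
have preimage_meas n (B : set R) : measurable B -> measurable (q n @^-1` B).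
  by move=> mB; rewrite -[X in measurable X]setTI; exact: measurable_funPT.
split=> E eps.
- move=> E_lt eps_def u.
  have eps_gt0 : 0 < eps by rewrite eps_def; lra.
  (* The thresholds [E + 2 * d] and [E - 2 * d] lie at distances [eps] and [4 * d + eps] below zero.
     The farther one selects fewer sites and gives the lower bound. *)
  apply: (limits_of_sandwich _ _ _ P _ _ _ (fun t n w => V w n <= - t)
    _ _ _ beta_inv decay beta_pos).
  + by move=> t n; rewrite left_setE; exact: preimage_meas.
  + move=> t n t0; rewrite left_setE -tailE//.
    by apply: pareto_left_tail_le; rewrite ?divr_gt0.
  (* The condition [a n <= t] puts [t / a n] at or beyond [1], where the tail formula is exact. *)
  + move=> t n t0 ant; rewrite left_setE -tailE//.
    by apply: pareto_left_tail; rewrite // ler_pdivlMr// mul1r.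
  + exact: eps_gt0.
  + by lra.
  + move=> L w; have := eigen_count_le_bounds _ _ (V w) L E.
    have -> : E - 2 * d%:R = - (4 * d%:R + eps) by rewrite eps_def; lra.
    by have -> : E + 2 * d%:R = - eps by rewrite eps_def; lra.
- move=> eps_gt0 E_def u.
  (* At the upper edge the signs are exchanged: [E - 2 * d] is at distance [eps] above zero and
     [E + 2 * d] at distance [4 * d + eps]. *)
  apply: (limits_of_sandwich _ _ _ P _ _ _ (fun t n w => t <= V w n)
    _ _ _ beta_inv decay beta_pos).
  + by move=> t n; rewrite right_setE; exact: preimage_meas.
  + move=> t n t0; rewrite right_setE -tailE//.
    by apply: pareto_right_tail_le; rewrite ?divr_gt0.
  + move=> t n t0 ant; rewrite right_setE -tailE//.
    by apply: pareto_right_tail; rewrite // ler_pdivlMr// mul1r.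
  + exact: eps_gt0.
  + by lra.
  + move=> L w; have := eigen_count_ge_bounds _ _ (V w) L E.
    have -> : E + 2 * d%:R = 4 * d%:R + eps by rewrite E_def; lra.
    by have -> : E - 2 * d%:R = eps by rewrite E_def; lra.
Qed.
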